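(* Let $(G,\triangleright)$ be a shelf equipped with a twist $\lambda:G\to\mathrm{Aut}(G,\triangleright)$ and let $(\alpha,\beta)$ be a dynamical pair on $G$ with coefficients in a set $E$. Let $(G\times E,\triangleright_\alpha)$ be the dynamical extension of $G$ via $\alpha$, i.e. $(a,s)\triangleright_\alpha(b,t)=(a\triangleright b,\alpha_{a,b}(s,t))$, and for $(a,s)\in G\times E$ define $\Lambda_{(a,s)}:G\times E\to G\times E$ by $$\Lambda_{(a,s)}(b,t)=\left(\lambda_a(b),\ \beta^{-1}_{a,\lambda_a(b)}(s,t)\right)$$ for all $b\in G$, $t\in E$. Then the map $\Lambda:G\times E\to\mathrm{Map}(G\times E,G\times E)$, $(a,s)\mapsto\Lambda_{(a,s)}$, is a twist for $(G\times E,\triangleright_\alpha)$ (in particular each $\Lambda_{(a,s)}$ is an automorphism of $(G\times E,\triangleright_\alpha)$).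
   Context: A (left) shelf is a non-empty set with a binary operation satisfying $a\triangleright(b\triangleright c)=(a\triangleright b)\triangleright(a\triangleright c)$. A twist (also called admissible twist) of a shelf $(D,\triangleright)$ is a map $\varphi:D\to\mathrm{Aut}(D,\triangleright)$, $a\mapsto\varphi_a$, such that $\varphi_a\varphi_b=\varphi_{\varphi_a(b)}\varphi_{\varphi_{\varphi_a(b)}^{-1}(\varphi_a(b)\triangleright a)}$ for all $a,b\in D$. $\mathrm{Map}(X,Y)$ is the set of maps $X\to Y$. Let $(G,\triangleright)$ be a shelf with twist $\lambda$, let $E$ be a set, and write $x\cdot y:=\lambda_x^{-1}(y)$. A dynamical pair on $G$ with coefficients in $E$ is a pair of maps $\alpha,\beta:G\times G\to\mathrm{Map}(E\times E,E)$ such that $\beta_{a,b}(s,-):E\to E$ is bijective for all $a,b\in G$, $s\in E$, and for all $a,b,c\in G$, $u,s,t\in E$: $$\alpha_{a,b\triangleright c}(u,\alpha_{b,c}(s,t))=\alpha_{a\triangleright b,a\triangleright c}(\alpha_{a,b}(u,s),\alpha_{a,c}(u,t)),$$ $$\alpha_{a\cdot b,a\cdot c}(\beta_{a,b}(u,s),\beta_{a,c}(u,t))=\beta_{a,b\triangleright c}(u,\alpha_{b,c}(s,t)),$$ $$\beta_{a\cdot b,a\cdot c}(\beta_{a,b}(u,s),\beta_{a,c}(u,t))=\beta_{b\cdot(b\triangleright a),b\cdot c}(\beta_{b,b\triangleright a}(s,\alpha_{b,a}(s,u)),\beta_{b,c}(s,t)).$$ The first identity ensures that $(G\times E,\triangleright_\alpha)$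 is a shelf. $\beta^{-1}_{a,b}(s,-)$ denotes the inverse of the bijection $\beta_{a,b}(s,-):E\to E$. *)

(* Defs.v *)
From mathcomp Require Export all_boot.
From mathcomp Require Export boolp classical_sets functions.

Set Implicit Arguments.
Unset Strict Implicit.
Unset Printing Implicit Defensive.

(* Total inverse: equal to the two-sided inverse of [f] when [f] is bijective
   (see [inverseK] and [inverseVK]); outside the range of [f] the value is the
   argument itself, which is irrelevant for bijections. *)
Definition inverse {T : Type} (f : T -> T) : T -> T := 'pinv_idfun [set: T] f.

Lemma inverseK (T : Type) (f : T -> T) : bijective f -> cancel f (inverse f).
Proof.
by move=> /bij_inj fI x; rewrite /inverse pinvKV ?in_setT // => y z _ _ /fI.
Qed.

Lemma inverseVK (T : Type) (f : T -> T) : bijective f -> cancel (inverse f) f.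
Proof.
move=> [g fK gK] x; rewrite /inverse pinvK //.
by rewrite inE; exists (g x) => //; exact: gK.
Qed.

Definition is_shelf (D : Type) (op : D -> D -> D) : Prop :=
  inhabited D /\ forall a b c, op a (op b c) = op (op a b) (op a c).

Definition is_automorphism (D : Type) (op : D -> D -> D) (f : D -> D) : Prop :=
  bijective f /\ {morph f : a b / op a b}.

Definition is_twist (D : Type) (op : D -> D -> D) (phi : D -> D -> D) : Prop :=
  (forall a, is_automorphism op (phi a)) /\
  (forall a b,
     phi a \o phi b =
     phi (phi a b) \o phi (inverse (phi (phi a b)) (op (phi a b) a))).

Definition twist_dot (G : Type) (lam : G -> G -> G) (x y : G) : G :=
  inverse (lam x) y.

Record is_dynamical_pair (G E : Type) (op : G -> G -> G) (lam : G -> G -> G)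
    (alpha beta : G -> G -> E * E -> E) : Prop := IsDynamicalPair {
  dp_bij : forall a b s, bijective (fun t => beta a b (s, t));
  dp_alpha : forall a b c u s t,
    alpha a (op b c) (u, alpha b c (s, t)) =
    alpha (op a b) (op a c) (alpha a b (u, s), alpha a c (u, t));
  dp_alpha_beta : forall a b c u s t,
    let dot := twist_dot lam in
    alpha (dot a b) (dot a c) (beta a b (u, s), beta a c (u, t)) =
    beta a (op b c) (u, alpha b c (s, t));
  dp_beta : forall a b c u s t,
    let dot := twist_dot lam in
    beta (dot a b) (dot a c) (beta a b (u, s), beta a c (u, t)) =
    beta (dot b (op b a)) (dot b c)
      (beta b (op b a) (s, alpha b a (s, u)), beta b c (s, t))
}.

Definition dyn_ext (G E : Type) (op : G -> G -> G)
    (alpha : G -> G -> E * E -> E) (x y : G * E) : G * E :=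
  (op x.1 y.1, alpha x.1 y.1 (x.2, y.2)).

Definition dyn_twist (G E : Type) (lam : G -> G -> G)
    (beta : G -> G -> E * E -> E) (x y : G * E) : G * E :=
  (lam x.1 y.1, inverse (fun t => beta x.1 (lam x.1 y.1) (x.2, t)) y.2).

(* Main.v *)
Require Import Defs.

(** A twist is easier to handle through the inverses of its values.  Write
    [x . y] for the image of [y] under the inverse of [phi x].  Substituting
    [b := a . b'] in the twist identity and inverting both sides turns it into
    [(a . b) . (a . c) = (b . (b |> a)) . (b . c)], a pure equation in the two
    operations [|>] and [.] without any inverse left (lemma [is_twist_dotP]).

    For the extended map, the inverse of [Lambda_(a, s)] sends [(b, t)] to
    [(a . b, beta_(a, b) (s, t))]: the inverse of [beta] in the definition of
    [Lambda] cancels out.  In this form, the first component of every identity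
    to be checked is the corresponding identity of the twist on [G], and the
    second component is one of the axioms of a dynamical pair: the mixed axiom
    on [alpha] and [beta] says that [(a, s) . -] is an endomorphism, and the
    axiom on [beta] alone is the twist identity.  Likewise the axiom on [alpha]
    alone is the second component of self-distributivity. *)

Lemma inverse_eq (T : Type) (f g : T -> T) :
  cancel f g -> cancel g f -> inverse f = g.
Proof.
move=> fK gK; apply: funext => x.
by rewrite -[in LHS](gK x) inverseK //; exists g.
Qed.

(** The change of variables [b := dot a b] is legitimate because [dot a] is
    onto, which is why the quantification over all [b] is preserved. *)
Lemma is_twist_dotP {D : Type} (op : D -> D -> D) {phi dot : D -> D -> D} :
    (forall a, cancel (phi a) (dot a)) -> (forall a, cancel (dot a) (phi a)) ->
  is_twist op phi <->
  (forall a, {morph dot a : x y / op x y}) /\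
  (forall a b c,
     dot (dot a b) (dot a c) = dot (dot b (op b a)) (dot b c)).
Proof.
move=> phiK dotK.
have invE a : inverse (phi a) = dot a by apply: inverse_eq.
split=> [[phi_aut phi_twist]|[dot_morph dot_twist]].
  split=> [a x y|a b c].
    by have [_ phi_morph] := phi_aut a; apply: (can_inj (phiK a));
      rewrite phi_morph !dotK.
  have := congr1 (@^~ (dot (dot a b) (dot a c))) (phi_twist a (dot a b)).
  by rewrite /= !dotK invE => cE; rewrite [in RHS]cE !phiK.
split=> [a|a b].
  split; first by exists (dot a).
  by move=> x y; apply: (can_inj (dotK a)); rewrite dot_morph !phiK.
apply: funext => c /=; rewrite invE.
have := dot_twist a (phi a b) (phi a (phi b c)).
by rewrite !phiK => cE; rewrite [in RHS]cE !dotK.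
Qed.

(** This is [twist_dot (dyn_twist lam beta)], computed: the inverse of [beta]
    inside [dyn_twist] is undone by the one inside [twist_dot]. *)
Definition dyn_dot {G E : Type} (lam : G -> G -> G)
    (beta : G -> G -> E * E -> E) (x y : G * E) : G * E :=
  (twist_dot lam x.1 y.1, beta x.1 y.1 (x.2, y.2)).

Lemma dyn_twistK {G E : Type} {lam : G -> G -> G} {beta : G -> G -> E * E -> E}
    (lam_bij : forall a, bijective (lam a))
    (beta_bij : forall a b s, bijective (fun t => beta a b (s, t))) x :
  cancel (dyn_twist lam beta x) (dyn_dot lam beta x).
Proof.
case: x => a s [b t]; rewrite /dyn_dot /dyn_twist /twist_dot /=.
by rewrite inverseK // (inverseVK (beta_bij a (lam a b) s)).
Qed.

Lemma dyn_dotK {G E : Type} {lam : G -> G -> G} {beta : G -> G -> E * E -> E}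
    (lam_bij : forall a, bijective (lam a))
    (beta_bij : forall a b s, bijective (fun t => beta a b (s, t))) x :
  cancel (dyn_dot lam beta x) (dyn_twist lam beta x).
Proof.
case: x => a s [b t]; rewrite /dyn_dot /dyn_twist /twist_dot /=.
by rewrite inverseVK // (inverseK (beta_bij a b s)).
Qed.

Lemma dyn_ext_shelf (G E : Type) (op : G -> G -> G)
    (alpha : G -> G -> E * E -> E) :
  is_shelf op -> inhabited E ->
  (forall a b c u s t,
    alpha a (op b c) (u, alpha b c (s, t)) =
    alpha (op a b) (op a c) (alpha a b (u, s), alpha a c (u, t))) ->
  is_shelf (dyn_ext op alpha).
Proof.
move=> [[g] opD] [e] alphaD; split; first by exists; exact: (g, e).
by move=> [a u] [b s] [c t]; rewrite /dyn_ext /= alphaD opD.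
Qed.

Theorem theorem4p4 (G E : Type) (op : G -> G -> G) (lam : G -> G -> G)
    (alpha beta : G -> G -> E * E -> E)
    (shelfG : is_shelf op) (twist_lam : is_twist op lam)
    (pair_ab : is_dynamical_pair op lam alpha beta) :
  (inhabited E -> is_shelf (dyn_ext op alpha)) /\
  is_twist (dyn_ext op alpha) (dyn_twist lam beta).
Proof.
have [beta_bij alphaD alpha_beta beta_beta] := pair_ab.
have lam_bij a : bijective (lam a) by have [/(_ a)[]] := twist_lam.
split=> [inhE|]; first exact: dyn_ext_shelf.
have lamK a : cancel (lam a) (twist_dot lam a) by exact: inverseK.
have dotK a : cancel (twist_dot lam a) (lam a) by exact: inverseVK.
have [dot_morph dot_twist] := (is_twist_dotP op lamK dotK).1 twist_lam.
apply/(is_twist_dotP _ (dyn_twistK lam_bij beta_bij)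
  (dyn_dotK lam_bij beta_bij)).
split=> [[a u] [b s] [c t]|[a u] [b s] [c t]].
  by rewrite /dyn_dot /dyn_ext /= dot_morph alpha_beta.
by rewrite /dyn_dot /dyn_ext /= dot_twist beta_beta.
Qed.
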